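(* Let $A=(a^{ij})_{i,j=1}^m$ be a (possibly unbounded) $C^1$ field of symmetric positive-definite matrices on $\mathbb{R}^m$, let $V\in C^2(\mathbb{R}^m)$ be such that $\mathrm{d}\mu(x)=e^{-V(x)}\mathrm{d}x$ is a probability measure, and let $$\mathrm{L}_a=\frac12\sum_{i,j=1}^m a^{ij}(x)\frac{\partial}{\partial x_i}\frac{\partial}{\partial x_j}+\sum_{i=1}^m b^i(x)\frac{\partial}{\partial x_i},\qquad b^i=\frac12\sum_{j=1}^m\left(\frac{\partial a^{ij}}{\partial x_j}-a^{ij}\frac{\partial V}{\partial x_j}\right).$$ Let $\lambda_{\mathrm{max}}(x)$ be the maximal eigenvalue of $A(x)$, and assume $\int\lambda_{\mathrm{max}}\,\mathrm{d}\mu<\infty$. Suppose there exist a function $W\in C^2(\mathbb{R}^m)$ with $W\geqslant 1$, constants $b\geqslant 0$ and $c>0$, and a point $x_0\in\mathbb{R}^m$ such that for any $x\in\mathbb{R}^m$ $$\mathrm{L}_aW(x)\leqslant \left(-c\,d^2(x,x_0)+b\right)\lambda_{\mathrm{max}}(x)\,W(x).$$ Then $\int e^{\delta d^2(x,x_0)}\lambda_{\mathrm{max}}(x)\,\mathrm{d}\mu(x)<\infty$ for any $\delta<\sqrt{c}$.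
   Context: $d(x,y)=|x-y|$ is the Euclidean distance on $\mathbb{R}^m$. The measure $\mu$ is invariant for $\mathrm{L}_a$. The carré du champ operator is $\Gamma_a(f,g)=\frac12[\mathrm{L}_a(fg)-f\mathrm{L}_ag-g\mathrm{L}_af]=\frac12\langle\nabla f,A\nabla g\rangle$, and for $f,g\in C_{\mathrm{c}}^\infty(\mathbb{R}^m)$ one has the integration by parts formula $-\int f\,\mathrm{L}_ag\,\mathrm{d}\mu=\int\Gamma_a(f,g)\,\mathrm{d}\mu=:\mathcal{E}_a(f,g)$. *)

(* Defs.v *)
From HB Require Import structures.
From mathcomp Require Import all_boot all_order all_algebra.
From mathcomp Require Import all_classical all_reals all_analysis.

Set Implicit Arguments.
Unset Strict Implicit.
Unset Printing Implicit Defensive.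

Import Order.TTheory GRing.Theory Num.Theory.
Import numFieldNormedType.Exports.

Local Open Scope classical_set_scope.
Local Open Scope ring_scope.

(* R^m is 'rV[R]_m.  Its sigma-algebra is the product one, generated by the
   coordinate maps (the analogue for row vectors of the library instance on
   tuples); it is the Borel sigma-algebra. *)
Definition measure_rV_display : measure_display -> measure_display.
Proof. exact. Qed.

Section measurable_rV.
Context {R : realType} (m : nat).

Let coor : 'I_m -> 'rV[R]_m -> measurableTypeR R := fun i x => x ord0 i.

Let rV_set0 : g_sigma_preimage coor set0.
Proof. exact: sigma_algebra0. Qed.

Let rV_setC A : g_sigma_preimage coor A -> g_sigma_preimage coor (~` A).
Proof. exact: sigma_algebraC. Qed.

Let rV_bigcup (F : (set 'rV[R]_m)^nat) :
  (forall i, g_sigma_preimage coor (F i)) ->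
  g_sigma_preimage coor (\bigcup_i (F i)).
Proof. exact: sigma_algebra_bigcup. Qed.

HB.instance Definition _ := @isMeasurable.Build
  (measure_rV_display (R.-ocitv.-measurable.-sigma))
  'rV[R]_m (g_sigma_preimage coor) rV_set0 rV_setC rV_bigcup.

End measurable_rV.

Section lebesgue_rV.
Context {R : realType}.
Local Open Scope ereal_scope.

Lemma measurable_fun_rV d (T : measurableType d) m (f : T -> 'rV[R]_m) :
  (forall i, measurable_fun [set: T]
     (fun t => f t ord0 i : measurableTypeR R)) ->
  measurable_fun [set: T] f.
Proof.
move=> mf _ B mB; rewrite setTI; move: B mB.
apply: (@smallest_sub _ (sigma_algebra [set: 'rV[R]_m])
  _ [set B | measurable (f @^-1` B)]).
  split => /=.
  - by rewrite preimage_set0; exact: measurable0.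
  - by move=> A mA; rewrite setTD preimage_setC; exact: measurableC.
  - by move=> F mF; rewrite preimage_bigcup; exact: bigcupT_measurable.
move=> B; rewrite -bigcup_seq => -[/= i _ [C mC <-]].
rewrite setTI -[X in measurable X]setTI.
exact: (mf i).
Qed.

(* (t, x) |-> (t, x_0, ..., x_(m-1)) *)
Definition rV_cons m (p : measurableTypeR R * 'rV[R]_m) : 'rV[R]_m.+1 :=
  row_mx (p.1 : R)%:M p.2 : 'rV[R]_(1 + m).

Lemma rV_consE m p : @rV_cons m p ord0 ord0 = p.1 /\
  forall i, @rV_cons m p ord0 (lift ord0 i) = p.2 ord0 i.
Proof.
split=> [|i].
  have -> : rV_cons p ord0 ord0 = rV_cons p ord0 (lshift m (ord0 : 'I_1)).
    by congr (rV_cons p _ _); exact: val_inj.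
  by apply: (etrans (row_mxEl _ _ _ _)); rewrite mxE eqxx.
have -> : rV_cons p ord0 (lift ord0 i) = rV_cons p ord0 (rshift 1 i).
  by congr (rV_cons p _ _); exact: val_inj.
exact: row_mxEr.
Qed.

Lemma measurable_coord m (i : 'I_m) :
  measurable_fun [set: 'rV[R]_m] (fun x => x ord0 i : measurableTypeR R).
Proof.
move=> _ Y mY; rewrite setTI; apply: sub_sigma_algebra => /=.
rewrite -bigcup_seq/=; exists i => /=; first by rewrite mem_index_enum.
by exists Y => //; rewrite setTI.
Qed.

Lemma measurable_rV_cons m : measurable_fun [set: _] (@rV_cons m).
Proof.
apply: measurable_fun_rV => i; case: (unliftP ord0 i) => [j ->|->].
  rewrite (_ : (fun t => _) = (fun x : 'rV[R]_m => x ord0 j) \o snd).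
    by apply: measurableT_comp => //; exact: measurable_coord.
  by apply/funext => p; have [_] := rV_consE p; apply.
rewrite (_ : (fun t => _) = fst) //.
by apply/funext => p; have [] := rV_consE p.
Qed.

Section succ.
Variables (m : nat) (mu : {measure set 'rV[R]_m -> \bar R}).

Definition lebesgue_rV_succ : set 'rV[R]_m.+1 -> \bar R :=
  pushforward (@lebesgue_measure R \x^ mu) (@rV_cons m).

Let mE A : lebesgue_rV_succ A = (@lebesgue_measure R \x^ mu) (@rV_cons m @^-1` A).
Proof. by []. Qed.

Let m0 : lebesgue_rV_succ set0 = 0.
Proof. by rewrite mE preimage_set0 measure0. Qed.

Let m_ge0 A : 0 <= lebesgue_rV_succ A.
Proof. by rewrite mE; exact: measure_ge0. Qed.

Let m_sigma_additive : semi_sigma_additive lebesgue_rV_succ.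
Proof.
have mcons := @measurable_rV_cons m.
move=> F mF tF mUF; rewrite /lebesgue_rV_succ /pushforward preimage_bigcup.
apply: measure_semi_sigma_additive.
- by move=> n; rewrite -[X in measurable X]setTI; exact: mcons.
- apply/trivIsetP => /= i j _ _ ij; rewrite -preimage_setI.
  by move/trivIsetP : tF => /(_ _ _ _ _ ij) ->//; rewrite preimage_set0.
- by rewrite -preimage_bigcup -[X in measurable X]setTI; exact: mcons.
Qed.

HB.instance Definition _ := isMeasure.Build _ _ _
  lebesgue_rV_succ m0 m_ge0 m_sigma_additive.
End succ.

(* Lebesgue measure on R^m, as the m-fold product of Lebesgue measure on R. *)
Fixpoint lebesgue_rV m : {measure set 'rV[R]_m -> \bar R} :=
  match m with
  | 0%N => \d_ (0%R : 'rV[R]_0)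
  | n.+1 => lebesgue_rV_succ (lebesgue_rV n)
  end.

Lemma lebesgue_rV_box m (B : 'I_m -> set (measurableTypeR R)) :
  (forall i, measurable (B i)) ->
  lebesgue_rV m [set x | forall i, B i (x ord0 i)] =
  \prod_(i < m) lebesgue_measure (B i).
Proof.
elim: m B => [|m IH] B mB.
  rewrite big_ord0 /= diracE mem_set//= => -[]//.
rewrite big_ord_recl -IH//.
pose C := [set x : 'rV[R]_m | forall i, B (lift ord0 i) (x ord0 i)].
have mC : measurable C.
  rewrite (_ : C = \bigcap_(i in [set: 'I_m])
      ((fun x : 'rV[R]_m => x ord0 i : measurableTypeR R) @^-1` B (lift ord0 i))).
    apply: fin_bigcap_measurable => // i _.
    by rewrite -[X in measurable X]setTI; exact: measurable_coord.
  by apply/seteqP; split => [x Cx i _|x Cx i]; [exact: Cx|exact: Cx i I].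
rewrite -(product_measure2E _ _ (mB ord0) mC) /= /lebesgue_rV_succ /pushforward.
congr (_ _); apply/seteqP; split => [p /= Bp|p /= [Bp Cp] i].
  have [p0 pS] := rV_consE p; split=> [|i]; first by rewrite -p0.
  by rewrite -pS.
have [p0 pS] := rV_consE p.
by case: (unliftP ord0 i) => [j ->|->]; rewrite ?pS ?p0.
Qed.

End lebesgue_rV.

Section calculus.
Context {R : realType} {m : nat}.
Implicit Types (f : 'rV[R]_m -> R) (x y : 'rV[R]_m).

Definition pderiv i f : 'rV[R]_m -> R := 'D_(delta_mx ord0 i) f.

Fixpoint Ck k f : Prop :=
  continuous f /\
  if k is k'.+1 then
    forall i, (forall x, derivable f x (delta_mx ord0 i)) /\ Ck k' (pderiv i f)
  else True.

(* The norm `|x - y| of 'rV[R]_m is the sup norm, hence this definition. *)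
Definition euclid_dist x y : R := Num.sqrt (\sum_i (x ord0 i - y ord0 i) ^+ 2).

Definition sym_posdef (M : 'M[R]_m) : Prop :=
  M^T = M /\ forall v : 'rV[R]_m, v != 0 -> 0 < (v *m M *m v^T) ord0 ord0.

(* For m > 0 and M symmetric, the set below is finite and nonempty, so that
   its sup is a maximum. *)
Definition lambda_max (M : 'M[R]_m) : R := sup [set l | eigenvalue M l].

Definition drift (A : 'rV[R]_m -> 'M[R]_m) (V : 'rV[R]_m -> R) i x : R :=
  2^-1 * \sum_j (pderiv j (fun y => A y i j) x - A x i j * pderiv j V x).

Definition diffusion_op (A : 'rV[R]_m -> 'M[R]_m) (V f : 'rV[R]_m -> R) x : R :=
  2^-1 * (\sum_i \sum_j A x i j * pderiv i (pderiv j f) x) +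
  \sum_i drift A V i x * pderiv i f x.

End calculus.

(* Main.v *)
Require Import Defs.
From HB Require Import structures.
From mathcomp Require Import all_boot all_order all_algebra.
From mathcomp Require Import all_classical all_reals all_analysis.
From mathcomp Require Import measurable_realfun ring lra.

(** Write [s(x)] for the squared distance to [x0], [lam(x)] for the largest
eigenvalue of [A(x)], [w = exp (- V)], and let [phi] be a C^1 function of [s]
with compact support. In divergence form the operator reads
[2 w L_a W = div (w A grad W)], hence the vector field
[F = w (phi(s)^2 / W) A grad W] has divergence
[w (2 phi^2 (L_a W) / W + 2 phi <grad phi, A u> - phi^2 <u, A u>)]
with [u = grad W / W]. Completing the square bounds the last two terms by
[<grad phi, A grad phi> <= 4 s phi'(s)^2 lam], and the Lyapunov condition
bounds the first one, so that
[div F <= 2 w lam ((- c s + b) phi(s)^2 + 2 s phi'(s)^2)].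
As [F] is compactly supported, [div F] integrates to [0]: this is the
integration by parts formula tested on [W] and [phi^2 / W].

For [phi(s) = exp (k s)] the parenthesis would be
[(- (c - 2 k^2) s + b) phi^2], which is at most [K - phi^2] for a constant
[K]; the estimate would then read
[\int exp (2 k s) lam dmu <= K \int lam dmu]. This [phi] is not compactly
supported, and [cutoff k eta] replaces it. Its logistic factor
[(exp (- k s) + eta)^-1] is bounded by [1 / eta] and grows at most as fast as
[exp (k s)] in the sense [theta' <= k theta]; the other factor vanishes for
[s >= eta^-2] and is so flat that its derivative only contributes a bounded
amount to [2 s phi'^2]. The two contributions to [phi'] are separated by
[(x - y)^2 <= 2 x^2 + 2 y^2]; the doubling turns [c - 2 k^2] into
[c - 4 k^2], which is positive when [2 k < sqrt c]. This is [cutoff_energy],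
and its constant [K] does not depend on [eta]. Since [cutoff k eta] increases
to [exp (k s)] as [eta] decreases to [0], monotone convergence concludes, with
[2 k] chosen between [delta] and [sqrt c].

The supporting facts are: the vanishing of the integral of a directional
derivative of a compactly supported function ([integral_pderiv_eq0], by
Fubini and the fundamental theorem of calculus in one coordinate), the
variational characterization and the continuity of [lam] ([lambda_maxP],
[continuous_lambda_max]), and the passage between [mu] and Lebesgue measure
([ge0_integral_density]). *)

Set Implicit Arguments.
Unset Strict Implicit.
Unset Printing Implicit Defensive.

Import Order.TTheory GRing.Theory Num.Theory.
Import numFieldNormedType.Exports.

Local Open Scope classical_set_scope.
Local Open Scope ring_scope.

(** * Continuity and directional derivatives of real-valued functions *)

Section continuity.
Context {R : realType} {T : topologicalType}.
Implicit Types f g : T -> R.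

Lemma continuous_mul f g :
  continuous f -> continuous g -> continuous (fun x => f x * g x).
Proof. by move=> cf cg x; exact: (cvgM (cf x) (cg x)). Qed.

Lemma continuous_add f g :
  continuous f -> continuous g -> continuous (fun x => f x + g x).
Proof. by move=> cf cg x; exact: (cvgD (cf x) (cg x)). Qed.

Lemma continuous_opp f : continuous f -> continuous (fun x => - f x).
Proof. by move=> cf x; exact: (cvgN (cf x)). Qed.

Lemma continuous_inv f :
  (forall x, f x != 0) -> continuous f -> continuous (fun x => (f x)^-1).
Proof. by move=> f0 cf x; exact: (cvgV (f0 x) (cf x)). Qed.

Lemma continuous_sum (I : Type) (s : seq I) (f : I -> T -> R) :
  (forall i, continuous (f i)) -> continuous (fun x => \sum_(i <- s) f i x).
Proof.
move=> cf; elim: s => [|i s IH].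
  by under eq_fun do rewrite big_nil; exact: cst_continuous.
by under eq_fun do rewrite big_cons; apply: continuous_add.
Qed.

Lemma continuous_compose (h : R -> R) (f : T -> R) :
  continuous h -> continuous f -> continuous (fun x => h (f x)).
Proof. by move=> ch cf x; apply: continuous_comp; [exact: cf|exact: ch]. Qed.

End continuity.

(** A directional derivative depends only on the restriction of the function to
the line through the point; this moves derivatives between spaces that share
such a line. *)
Lemma is_derive_line (R : realType) (V1 V2 W : normedModType R)
    (f1 : V1 -> W) (f2 : V2 -> W) x1 x2 v1 v2 d :
  (forall h : R, f1 (h *: v1 + x1) = f2 (h *: v2 + x2)) ->
  is_derive x1 v1 f1 d -> is_derive x2 v2 f2 d.
Proof.
move=> f12 [D1 <-].
have E : (fun h : R => h^-1 *: ((f1 \o shift x1) (h *: v1) - f1 x1)) =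
         (fun h : R => h^-1 *: ((f2 \o shift x2) (h *: v2) - f2 x2)).
  have := f12 0; rewrite !scale0r !add0r => f0.
  by apply/funext => h /=; rewrite f0 f12.
by split; rewrite /derivable /derive -E.
Qed.

Section derivation.
Context {R : realType} {V : normedModType R}.
Implicit Types (f g : V -> R) (x v : V).

Lemma is_derive_const (a : R) x v : is_derive x v (fun=> a) 0.
Proof. exact: is_derive_cst. Qed.

Lemma is_derive_add f g x v df dg : is_derive x v f df -> is_derive x v g dg ->
  is_derive x v (fun y => f y + g y) (df + dg).
Proof. exact: is_deriveD. Qed.

Lemma is_derive_mul f g x v df dg : is_derive x v f df -> is_derive x v g dg ->
  is_derive x v (fun y => f y * g y) (df * g x + f x * dg).
Proof.
move=> Df Dg; apply: (is_derive_eq (is_deriveM Df Dg)).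
by rewrite /GRing.scale/=; ring.
Qed.

Lemma is_derive_bigsum (I : Type) (s : seq I) (f : I -> V -> R) x v (df : I -> R) :
  (forall i, is_derive x v (f i) (df i)) ->
  is_derive x v (fun y => \sum_(i <- s) f i y) (\sum_(i <- s) df i).
Proof.
move=> Df; elim: s => [|i s IH].
  by under eq_fun do rewrite big_nil; rewrite big_nil; exact: is_derive_const.
by under eq_fun do rewrite big_cons; rewrite big_cons; exact: is_derive_add.
Qed.

Lemma is_derive_chain (h : R -> R) f x v dh df :
  is_derive (f x) 1 h dh -> is_derive x v f df ->
  is_derive x v (fun y => h (f y)) (dh * df).
Proof.
move=> Dh Df.
pose g (t : R) := f (t *: v + x).
have g0 : g 0 = f x by rewrite /g scale0r add0r.
have Dg : is_derive (0 : R) 1 g df.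
  by apply: is_derive_line Df => t; rewrite /g /GRing.scale/= mulr1 addr0.
have Dhg : is_derive (0 : R) 1 (h \o g) (dh * df).
  by apply: is_derive1_comp => //; rewrite g0.
by apply: is_derive_line Dhg => t; rewrite /= /g /GRing.scale/= mulr1 addr0.
Qed.

End derivation.

Section derivation_real.
Context {R : realType}.

Lemma is_derive_inv (s : R) : s != 0 ->
  is_derive s 1 (fun t : R => t^-1) (- (s^-1 ^+ 2)).
Proof.
move=> s0; have := @is_deriveV R id s 1 1 s0 (is_derive_id _ _).
by move/is_derive_eq; apply; rewrite /GRing.scale/= mulr1 exprVn.
Qed.

Lemma is_derive_continuous (f df : R -> R) :
  (forall s : R, is_derive s 1 f (df s)) -> continuous f.
Proof.
move=> D s; apply: differentiable_continuous; apply/derivable1_diffP.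
exact: ex_derive.
Qed.

End derivation_real.

(** * Lebesgue measure and integration by parts on R^m *)

Section borel.
Context {R : realType} {m : nat}.

Lemma nbhs_rV_coord (x : 'rV[R]_m) (U : set 'rV[R]_m) : nbhs x U ->
  exists2 e : R, 0 < e &
    forall y : 'rV[R]_m, (forall i, `|x ord0 i - y ord0 i| < e) -> U y.
Proof.
move=> /nbhs_ballP[e /= e0 eU]; exists e => // y xy; apply: eU.
by split=> // i j; rewrite [i]ord1; exact: xy.
Qed.

Definition grid (n : nat) (k : 'rV[int]_m) : 'rV[R]_m :=
  \row_i ((k ord0 i)%:~R / n.+1%:R).

Definition grid_cell (n : nat) (x : 'rV[R]_m) : 'rV[int]_m :=
  \row_i Num.floor (x ord0 i * n.+1%:R).

Lemma cvg_grid (x : 'rV[R]_m) :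
  grid n (grid_cell n x) @[n --> \oo] --> x.
Proof.
move=> U /nbhs_rV_coord[e e0 eU].
have [N _ HN] := near_infty_natSinv_lt (PosNum e0).
exists N => // n /= Nn; apply: eU => i; rewrite !mxE.
apply: le_lt_trans (HN n Nn).
have n0 : (0 : R) < n.+1%:R by rewrite ltr0n.
have /andP[h1 h2] := floor_itv (x ord0 i * n.+1%:R).
rewrite -{1}[x ord0 i](mulfK (lt0r_neq0 n0)) -mulrBl normrM.
rewrite (gtr0_norm (x := _^-1)) ?invr_gt0// ler_piMl ?invr_ge0 ?ltW//.
by rewrite ger0_norm ?subr_ge0// ltrBlDl -(intrD _ _ 1).
Qed.

Lemma measurable_grid_cell n (k : 'rV[int]_m) :
  measurable (grid_cell n @^-1` [set k]).
Proof.
pose J i : set R :=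
  `[(k ord0 i)%:~R / n.+1%:R, (k ord0 i + 1)%:~R / n.+1%:R[%classic.
rewrite (_ : _ @^-1` _ = \bigcap_(i in [set: 'I_m])
    ((fun x : 'rV[R]_m => x ord0 i : measurableTypeR R) @^-1` J i)); last first.
  have n0 : (0 : R) < n.+1%:R by rewrite ltr0n.
  apply/seteqP; split=> [x/= xk i _|x/= xk].
    have := floor_itv (x ord0 i * n.+1%:R).
    rewrite /J /= in_itv/= ler_pdivrMr// ltr_pdivlMr//.
    by rewrite -xk mxE.
  apply/rowP => i; rewrite mxE; apply/eqP; rewrite floor_eq.
  by have := xk i I; rewrite /J /= in_itv/= ler_pdivrMr// ltr_pdivlMr//.
apply: fin_bigcap_measurable => // i _.
by rewrite -[X in measurable X]setTI; apply: measurable_coord;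
  [|exact: measurable_itv].
Qed.

(** The sigma-algebra is generated by the coordinates, hence contains the
grid cells; [f] is the pointwise limit of the functions
[f \o grid n \o grid_cell n], which take countably many values. *)
Lemma continuous_measurable_rV (f : 'rV[R]_m -> R) :
  continuous f -> measurable_fun setT f.
Proof.
move=> cf; apply: (@measurable_fun_cvg _ _ _ _
  (fun n x => f (grid n (grid_cell n x)))).
  move=> n _ B mB; rewrite setTI.
  rewrite (_ : _ @^-1` B = \bigcup_(k in [set k | B (f (grid n k))])
      (grid_cell n @^-1` [set k])); last first.
    apply/seteqP; split => [x/= Bx|x/= [k Bk /= ->]//].
    by exists (grid_cell n x).
  rewrite bigcup_mkcond; apply: countable_bigcupT_measurable => [|k].
    exact: countableP.
  by case: ifPn => // _; exact: measurable_grid_cell.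
by move=> x _; apply: continuous_cvg; [exact: cf|exact: cvg_grid].
Qed.
End borel.

Section lebesgue.
Context {R : realType}.

Definition cube m (r : R) : set 'rV[R]_m :=
  [set x | forall i, `|x ord0 i| <= r].
Arguments cube : clear implicits.

Let cubeE m (r : R) : cube m r =
  [set x | forall i, (`[- r, r]%classic : set (measurableTypeR R)) (x ord0 i)].
Proof.
by apply/seteqP; split=> x /= h i; have := h i; rewrite /= in_itv/= ler_norml.
Qed.

Lemma measurable_cube m (r : R) : measurable (cube m r).
Proof.
rewrite (_ : cube m r = \bigcap_(i in [set: 'I_m])
    ((fun x : 'rV[R]_m => x ord0 i : measurableTypeR R) @^-1` `[- r, r]%classic)).
  apply: fin_bigcap_measurable => // i _.
  by rewrite -[X in measurable X]setTI; apply: measurable_coord;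
  [|exact: measurable_itv].
by rewrite cubeE; apply/seteqP; split=> [x h i _|x h i]; [exact: h|exact: h i I].
Qed.

Lemma lebesgue_cube_fin m (r : R) : (lebesgue_rV m (cube m r) < +oo)%E.
Proof.
rewrite cubeE (lebesgue_rV_box (B := fun=> `[- r, r]%classic)) => [|i]; last first.
  exact: measurable_itv.
suff : (0 <= \prod_(i < m) lebesgue_measure
    (`[(- r)%R, r]%classic : set (measurableTypeR R)) < +oo)%E by case/andP.
apply: (big_ind (fun x : \bar R => (0 <= x < +oo)%E)).
- by rewrite lee01 ltry.
- move=> x y /andP[x0 xoo] /andP[y0 yoo]; rewrite mule_ge0//=.
  by rewrite lte_mul_pinfty// ge0_fin_numE.
- move=> i _; rewrite measure_ge0/= lebesgue_measure_itv/=.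
  by case: ifPn => _; rewrite ?ltry// -EFinN -EFinD ltry.
Qed.

Lemma sigma_finite_lebesgue_rV m :
  sigma_finite setT (lebesgue_rV m : set 'rV[R]_m -> \bar R).
Proof.
exists (fun n => cube m n%:R).
  apply/esym/seteqP; split=> // x _.
  exists (Num.bound (\sum_i `|x ord0 i|)) => // i /=.
  apply: le_trans (ltW (archi_boundP _)); last exact: sumr_ge0.
  by rewrite (bigD1 i)//= lerDl sumr_ge0.
by move=> n; split; [exact: measurable_cube|exact: lebesgue_cube_fin].
Qed.

(** [lebesgue_rV m] is a projection out of a recursively defined measure; the
sigma-finite structure needs a constant of its own to be attached to. *)
Definition leb m : set 'rV[R]_m -> \bar R := lebesgue_rV m.
Arguments leb : clear implicits.

HB.instance Definition _ m := isMeasure.Build _ _ _ (leb m)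
  (measure0 (lebesgue_rV m)) (measure_ge0 (lebesgue_rV m))
  (@measure_semi_sigma_additive _ _ _ (lebesgue_rV m)).

HB.instance Definition _ m :=
  Measure_isSigmaFinite.Build _ _ _ (leb m) (@sigma_finite_lebesgue_rV m).

Lemma integrable_continuous_cube m (g : 'rV[R]_m -> R) r : continuous g ->
  (forall x, ~ cube m r x -> g x = 0) ->
  (leb m).-integrable setT (EFin \o g).
Proof.
move=> cg g0.
have -> : EFin \o g = (EFin \o g) \_ (cube m r).
  apply/funext => x; rewrite patchE; case: ifPn => //= /negP xr.
  by rewrite g0//; apply: contra_not xr => /mem_set.
apply: (integrable_mkcond _ (@measurable_cube m r)).1.
apply: (@measurable_bounded_integrable _ _ _ _ g).
- exact: measurable_cube.
- exact: lebesgue_cube_fin.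
- exact: measurable_funTS (continuous_measurable_rV cg).
have ccube : compact (cube m r).
  rewrite cubeE.
  exact: (@rV_compact R m (fun=> `[- r, r]%classic)
    (fun=> @segment_compact _ _ _)).
have := compact_bounded (continuous_compact (continuous_subspaceT cg) ccube).
move=> [M [Mr HM]]; exists M; split=> // x Mx y cy.
by apply: HM => //; exists y.
Qed.

End lebesgue.
Arguments cube {R} m r.
Arguments leb {R} m.

Section ibp.
Context {R : realType}.

Lemma rV_cons_shiftl m (h t : R) (y : 'rV[R]_m) :
  rV_cons (h + t, y) = h *: delta_mx ord0 ord0 + rV_cons (t, y).
Proof.
apply/rowP => i.
rewrite [RHS]mxE [X in _ = X + _]mxE [X in _ = _ * X + _]mxE eqxx/=.
have [p0 pS] := rV_consE (h + t, y); have [q0 qS] := rV_consE (t, y).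
case: (unliftP ord0 i) => [j ->|->]; first by rewrite pS qS/= mulr0 add0r.
by rewrite p0 q0 eqxx mulr1.
Qed.

Lemma rV_cons_shiftr m (h t : R) (y : 'rV[R]_m) j :
  rV_cons (t, h *: delta_mx ord0 j + y) =
  h *: delta_mx ord0 (lift ord0 j) + rV_cons (t, y).
Proof.
apply/rowP => i.
rewrite [RHS]mxE [X in _ = X + _]mxE [X in _ = _ * X + _]mxE eqxx/=.
have [p0 pS] := rV_consE (t, h *: delta_mx ord0 j + y).
have [q0 qS] := rV_consE (t, y).
case: (unliftP ord0 i) => [k ->|->]; last by rewrite p0 q0 /= mulr0 add0r.
by rewrite pS qS/= !mxE eqxx/= (inj_eq (@lift_inj _ _)).
Qed.

Lemma continuous_rV_consl m (y : 'rV[R]_m) :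
  continuous (fun t : R => rV_cons (t, y)).
Proof.
move=> t U /nbhs_rV_coord[e e0 eU]; apply/nbhs_ballP; exists e => // s ts.
apply: eU => i.
have [p0 pS] := rV_consE (s, y); have [q0 qS] := rV_consE (t, y).
by case: (unliftP ord0 i) => [j ->|->]; rewrite ?pS ?qS ?p0 ?q0// subrr normr0.
Qed.

Lemma continuous_rV_consr m (t : R) :
  continuous (fun y : 'rV[R]_m => rV_cons (t, y)).
Proof.
move=> y U /nbhs_rV_coord[e e0 eU]; apply/nbhs_ballP; exists e => // z yz.
apply: eU => i.
have [p0 pS] := rV_consE (t, y); have [q0 qS] := rV_consE (t, z).
case: (unliftP ord0 i) => [j ->|->]; rewrite ?pS ?qS ?p0 ?q0/= ?subrr ?normr0//.
by case: yz => _; apply.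
Qed.

Lemma integral_derive_eq0 (F f : R -> R) (r : R) :
  (forall x : R, is_derive x 1 F (f x)) -> continuous f ->
  (forall x, r < `|x| -> F x = 0) ->
  (forall x, r < `|x| -> f x = 0) ->
  (\int[lebesgue_measure]_x (f x)%:E = 0)%E.
Proof.
move=> dF cf F0 f0.
pose a := `|r| + 1.
have a0 : 0 < a by rewrite ltr_wpDl.
have ra : r < a by rewrite (le_lt_trans (ler_norm r))// ltrDl.
have fE : (fun x => (f x)%:E) = (fun x => (f x)%:E) \_ (`[- a, a]%classic : set R).
  apply/funext => x; rewrite patchE; case: ifPn => // /negP xa.
  rewrite f0//; apply: lt_trans ra _; rewrite ltNge; apply/negP => xa'.
  by apply: xa; apply/mem_set; rewrite /= in_itv/= -ler_norml.
rewrite fE -integral_mkcond (@continuous_FTC2 _ f F)//.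
- by rewrite !F0 ?subee ?normrN ?(ger0_norm (ltW a0)).
- by rewrite gtrN.
- exact: continuous_subspaceT.
- have cF x : {for x, continuous F}.
    by apply: differentiable_continuous; apply/derivable1_diffP; apply: ex_derive.
  split; last 2 first.
  + exact/cvg_at_right_filter/cF.
  + exact/cvg_at_left_filter/cF.
  by move=> x _; apply: ex_derive.
- by move=> x _; rewrite derive1E; exact: derive_val.
Qed.

Section fubini.
Variables (m : nat) (g : 'rV[R]_m.+1 -> R).
Hypothesis mg : measurable_fun setT g.
Hypothesis ig : (leb m.+1).-integrable setT (EFin \o g).

Let mcons := @measurable_rV_cons R m.

Let mgcons : measurable_fun setT (EFin \o g \o @rV_cons R m).
Proof. by apply: measurableT_comp; [exact/measurable_EFinP|exact: mcons]. Qed.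

Let integral_leb (f : 'rV[R]_m.+1 -> \bar R) :
  measurable_fun setT f -> (forall x, 0 <= f x)%E ->
  (\int[leb m.+1]_x f x = \int[@lebesgue_measure R \x^ leb m]_p f (rV_cons p))%E.
Proof.
move=> mf f0.
exact: (ge0_integral_pushforward mcons (@lebesgue_measure R \x^ leb m)%E
  (D := setT) measurableT mf (in1W f0)).
Qed.

Let igcons1 : (@lebesgue_measure R \x^ leb m)%E.-integrable setT
  (EFin \o g \o @rV_cons R m).
Proof.
apply/integrableP; split; first exact: mgcons.
have mabs : measurable_fun setT (fun x => `|(EFin \o g) x|)%E.
  by apply: measurableT_comp => //; exact/measurable_EFinP.
by have /integrableP[_] := ig; rewrite (integral_leb mabs).
Qed.

(* The hypothesis of Fubini's theorem concerns the product measure built in the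
   other order, which is the same by uniqueness. *)
Let igcons : (@lebesgue_measure R \x leb m)%E.-integrable setT
  (EFin \o g \o @rV_cons R m).
Proof.
apply/integrableP; split; first exact: mgcons.
have /integrableP[_] := igcons1; apply: le_lt_trans.
rewrite (eq_measure_integral (@lebesgue_measure R \x^ leb m)%E)//= => A mA _.
by apply: product_measure_unique => // B C mB mC/=; rewrite product_measure2E.
Qed.

Let integral_lebE : (\int[leb m.+1]_x (g x)%:E =
  \int[@lebesgue_measure R \x^ leb m]_p (g (rV_cons p))%:E)%E.
Proof.
apply: (integral_pushforward mcons (mu := (@lebesgue_measure R \x^ leb m)%E)
  (D := setT) (f := EFin \o g)) => //.
exact/measurable_EFinP.
Qed.

Lemma integral_leb_outer_tail : (\int[leb m.+1]_x (g x)%:E =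
  \int[leb m]_y \int[lebesgue_measure]_t (g (rV_cons (t, y)))%:E)%E.
Proof. by rewrite integral_lebE -(integral21_prod_meas2 igcons). Qed.

Lemma integral_leb_outer_head : (\int[leb m.+1]_x (g x)%:E =
  \int[lebesgue_measure]_t \int[leb m]_y (g (rV_cons (t, y)))%:E)%E.
Proof. by rewrite integral_lebE -(integral12_prod_meas2 igcons). Qed.
End fubini.

(** By induction on the dimension: integrating first along the direction of
differentiation, when it is the first coordinate, leaves a one-variable
derivative; otherwise the first coordinate is frozen. *)
Lemma integral_pderiv_eq0 m (i : 'I_m) (F G : 'rV[R]_m -> R) (r : R) :
  (forall x, is_derive x (delta_mx ord0 i) F (G x)) -> continuous G ->
  (forall x, ~ cube m r x -> F x = 0) ->
  (forall x, ~ cube m r x -> G x = 0) ->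
  (\int[leb m]_x (G x)%:E = 0)%E.
Proof.
elim: m => [|m IH] in i F G *; first by case: i.
move=> dF cG F0 G0.
have mG := continuous_measurable_rV cG.
have iG := integrable_continuous_cube cG G0.
have ncubel (t : R) (y : 'rV[R]_m) : r < `|t| -> ~ cube m.+1 r (rV_cons (t, y)).
  move=> rt /(_ ord0); have [-> _] := rV_consE (t, y).
  by rewrite leNgt rt.
have ncuber (t : R) (y : 'rV[R]_m) :
    ~ cube m r y -> ~ cube m.+1 r (rV_cons (t, y)).
  move=> ny yr; apply: ny => j; have := yr (lift ord0 j).
  by have [_ ->] := rV_consE (t, y).
case: (unliftP ord0 i) => [j ij|i0].
  rewrite (integral_leb_outer_head mG iG); apply: integral0_eq => t _.
  apply: (IH j (fun y => F (rV_cons (t, y))) (fun y => G (rV_cons (t, y)))).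
  - move=> y; have := dF (rV_cons (t, y)); rewrite ij.
    by apply: is_derive_line => h; rewrite rV_cons_shiftr.
  - by move=> y; apply: continuous_comp; [exact: continuous_rV_consr|exact: cG].
  - by move=> y /ncuber => /(_ t)/F0.
  - by move=> y /ncuber => /(_ t)/G0.
rewrite (integral_leb_outer_tail mG iG); apply: integral0_eq => y _.
apply: (@integral_derive_eq0 (fun t => F (rV_cons (t, y)))
  (fun t => G (rV_cons (t, y))) r).
- move=> t; have := dF (rV_cons (t, y)); rewrite i0.
  by apply: is_derive_line => h; rewrite /GRing.scale/= mulr1 rV_cons_shiftl.
- by move=> t; apply: continuous_comp; [exact: continuous_rV_consl|exact: cG].
- by move=> t /ncubel => /(_ y)/F0.
- by move=> t /ncubel => /(_ y)/G0.
Qed.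

End ibp.

Section density.
Context {R : realType}.

(** The density [h] agrees almost everywhere with the Radon-Nikodym derivative,
for which the change of variables is known. *)
Lemma ge0_integral_density d (T : measurableType d)
    (nu : probability T R) (mu : {sigma_finite_measure set T -> \bar R})
    (h : T -> R) :
  (forall x, 0 <= h x) -> measurable_fun setT h ->
  (forall B, measurable B -> nu B = \int[mu]_(x in B) (h x)%:E)%E ->
  forall f : T -> R, (forall x, 0 <= f x) -> measurable_fun setT f ->
  (\int[nu]_x (f x)%:E = \int[mu]_x (f x * h x)%:E)%E.
Proof.
move=> h0 mh nuE f f0 mf.
have mEh : measurable_fun setT (EFin \o h) by exact/measurable_EFinP.
have mEf : measurable_fun setT (EFin \o f) by exact/measurable_EFinP.
have numu : nu `<< mu.
  apply/null_content_dominatesP => A mA muA0.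
  by rewrite nuE// null_set_integral//; exact: measurable_funTS.
rewrite -(Radon_Nikodym_SigmaFinite.change_of_variables numu)//.
apply: ae_eq_integral => //.
- apply: emeasurable_funM => //.
  exact: measurable_int (Radon_Nikodym_SigmaFinite.f_integrable numu).
- by apply/measurable_EFinP; exact: measurable_funM.
have RNh : ae_eq mu setT (Radon_Nikodym_SigmaFinite.f nu mu) (EFin \o h).
  apply: integral_ae_eq => //.
    exact: Radon_Nikodym_SigmaFinite.f_integrable.
  by move=> E _ mE; rewrite -nuE// -Radon_Nikodym_SigmaFinite.f_integral.
exact: ae_eqe_mul2l RNh.
Qed.
End density.

(** * The largest eigenvalue of a symmetric matrix *)

Section rayleigh.
Context {R : realType} {m : nat}.
Implicit Types (M N : 'M[R]_m) (u v : 'rV[R]_m).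

Definition bil M u v : R := (u *m M *m v^T) ord0 ord0.

Definition sqn v : R := \sum_i v ord0 i ^+ 2.

Lemma bil_sum M u v : bil M u v = \sum_i \sum_j M i j * (u ord0 i * v ord0 j).
Proof.
rewrite /bil mxE exchange_big/=; apply: eq_bigr => j _.
by rewrite !mxE mulr_suml; apply: eq_bigr => i _; ring.
Qed.

Lemma bilC M u v : M^T = M -> bil M u v = bil M v u.
Proof.
move=> sM; rewrite !bil_sum exchange_big/=; apply: eq_bigr => i _.
by apply: eq_bigr => j _; rewrite -{1}sM mxE; ring.
Qed.

Lemma bilDl M u1 u2 v : bil M (u1 + u2) v = bil M u1 v + bil M u2 v.
Proof. by rewrite /bil !mulmxDl mxE. Qed.

Lemma bilZl M a u v : bil M (a *: u) v = a * bil M u v.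
Proof. by rewrite /bil -!scalemxAl mxE. Qed.

Lemma bil_expand M u v a b : M^T = M ->
  bil M (a *: u + b *: v) (a *: u + b *: v) =
  a ^+ 2 * bil M u u + 2 * a * b * bil M u v + b ^+ 2 * bil M v v.
Proof.
move=> sM; rewrite bilDl !bilZl.
rewrite [bil M u _](bilC _ _ sM) [bil M v _](bilC _ _ sM) !bilDl !bilZl.
by rewrite (bilC v u sM); ring.
Qed.

Lemma sqn_ge0 v : 0 <= sqn v.
Proof. by apply: sumr_ge0 => i _; exact: sqr_ge0. Qed.

Lemma sqnZ a v : sqn (a *: v) = a ^+ 2 * sqn v.
Proof. by rewrite /sqn mulr_sumr; apply: eq_bigr => i _; rewrite mxE exprMn. Qed.

Lemma sqn_eq0 v : sqn v = 0 -> v = 0.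
Proof.
move=> /eqP; rewrite psumr_eq0 => [|i _]; last exact: sqr_ge0.
move=> /allP h; apply/rowP => i; rewrite mxE; apply/eqP.
by rewrite -sqrf_eq0; apply: h; rewrite mem_index_enum.
Qed.

Lemma bil_sub M N u v : bil (M - N) u v = bil M u v - bil N u v.
Proof. by rewrite /bil mulmxBr mulmxBl !mxE. Qed.

Lemma bil_scalar a v : bil a%:M v v = a * sqn v.
Proof.
rewrite /bil mul_mx_scalar -scalemxAl mxE; congr (_ * _).
by rewrite mxE; apply: eq_bigr => i _; rewrite mxE expr2.
Qed.

Lemma le_sqn v i : v ord0 i ^+ 2 <= sqn v.
Proof. by rewrite /sqn (bigD1 i)//= lerDl sumr_ge0// => j _; exact: sqr_ge0. Qed.

Lemma le_bil_unit M v : sqn v = 1 -> bil M v v <= \sum_i \sum_j `|M i j|.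
Proof.
move=> v1; rewrite bil_sum; apply: ler_sum => i _; apply: ler_sum => j _.
apply: le_trans (ler_norm _) _; rewrite normrM ler_piMr//.
have le1 k : `|v ord0 k| <= 1.
  rewrite -(@ler_pXn2r _ 2)// ?nnegrE// expr1n real_normK ?num_real//.
  by rewrite -v1 le_sqn.
by rewrite normrM mulr_ile1.
Qed.

Lemma continuous_coord (i : 'I_m) : continuous (fun v : 'rV[R]_m => v ord0 i).
Proof. exact: coord_continuous. Qed.

Lemma continuous_sqn : continuous sqn.
Proof.
apply: continuous_sum => i; under eq_fun do rewrite expr2.
by apply: continuous_mul; exact: continuous_coord.
Qed.

Lemma continuous_bil M : continuous (fun v => bil M v v).
Proof.
under eq_fun do rewrite bil_sum.
apply: continuous_sum => i; apply: continuous_sum => j.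
apply: continuous_mul; first exact: cst_continuous.
by apply: continuous_mul; exact: continuous_coord.
Qed.

Lemma compact_sphere : compact [set v : 'rV[R]_m | sqn v = 1].
Proof.
apply: bounded_closed_compact; last first.
  apply: (@closed_comp _ _ sqn [set 1]) => [v _|]; first exact: continuous_sqn.
  exact: closed_eq.
exists 1; split => // a a1 v /= v1; apply: le_trans (ltW a1).
rewrite [leLHS]/Num.norm/= mx_normrE; apply/bigmax_leP; split=> // -[i j] _ /=.
rewrite [i]ord1 -(@ler_pXn2r _ 2)// ?nnegrE// expr1n real_normK ?num_real//.
by rewrite -v1 le_sqn.
Qed.

Hypothesis m_gt0 : (0 < m)%N.

(** The quadratic form attains its maximum on the compact unit sphere, and both
sides are homogeneous of degree two in [v]. *)
Lemma rayleigh_max M : exists2 w : 'rV[R]_m, sqn w = 1 &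
  forall v, bil M v v <= bil M w w * sqn v.
Proof.
have S0 : [set v : 'rV[R]_m | sqn v = 1] !=set0.
  exists (delta_mx ord0 (Ordinal m_gt0)) => /=.
  rewrite /sqn (bigD1 (Ordinal m_gt0))//= big1 ?addr0 => [|i ni].
    by rewrite mxE !eqxx expr1n.
  by rewrite mxE (negPf ni) andbF expr0n.
have [w /set_mem w1 wmax] := EVT_max_rV S0 compact_sphere
  (continuous_subspaceT (@continuous_bil M)).
exists w => // v; have [v0|v0] := eqVneq (sqn v) 0.
  by rewrite v0 mulr0 (sqn_eq0 v0) /bil !mul0mx mxE.
have vgt0 : 0 < sqn v by rewrite lt_neqAle eq_sym v0 sqn_ge0.
pose a := (Num.sqrt (sqn v))^-1.
have a2 : a ^+ 2 = (sqn v)^-1 by rewrite /a exprVn sqr_sqrtr ?sqn_ge0.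
have /wmax : a *: v \in [set v : 'rV[R]_m | sqn v = 1].
  by apply/mem_set; rewrite /= sqnZ a2 mulVf.
have -> : bil M (a *: v) (a *: v) = a ^+ 2 * bil M v v.
  by rewrite bilZl /bil linearZ/= -scalemxAr mxE mulrA -expr2.
by rewrite a2 mulrC ler_pdivrMr.
Qed.

(** First-order optimality: for [z = w M], the form at [w + t z] is
[2 t |z|^2 + O(t^2)], which is positive for small [t > 0] unless [z = 0]. *)
Lemma nonpos_isotropic M w : M^T = M -> (forall v, bil M v v <= 0) ->
  bil M w w = 0 -> w *m M = 0.
Proof.
move=> sM M0 w0; apply/sqn_eq0/eqP; rewrite eq_le sqn_ge0 andbT.
set z := w *m M.
have wz : bil M w z = sqn z.
  by rewrite -[RHS]mul1r -bil_scalar /bil mulmx1.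
(* [t] is small enough for the quadratic term to be at most [t |z|^2] in
   absolute value. *)
pose t := sqn z / (`|bil M z z| + 1).
have d0 : 0 < `|bil M z z| + 1 by rewrite ltr_wpDl.
rewrite leNgt; apply/negP => z0.
have t0 : 0 < t by rewrite divr_gt0.
have := M0 (1 *: w + t *: z); rewrite (bil_expand _ _ _ _ sM) w0 wz.
have tz : - sqn z <= t * bil M z z.
  rewrite lerNl -mulrN (le_trans (ler_wpM2l (ltW t0) (ler_norm _)))// normrN.
  rewrite /t mulrAC ler_pdivrMr// ler_pM2l// lerDl//.
nra.
Qed.

(** A maximizer [w] of the form on the sphere, with maximum [l], is an
eigenvector: [M - l] is nonpositive and [w] is isotropic for it. Testing the
maximality of [l] on any other eigenvector shows that [l] is the largest
eigenvalue. *)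
Lemma lambda_maxP M : M^T = M -> exists w, [/\ sqn w = 1,
  bil M w w = lambda_max M & forall v, bil M v v <= lambda_max M * sqn v].
Proof.
move=> sM; have [w w1 wmax] := rayleigh_max M; exists w.
suff <- : bil M w w = lambda_max M by [].
set l := bil M w w.
have ub : ubound [set a | eigenvalue M a] l.
  move=> a /eigenvalueP[v va v0].
  have := wmax v; rewrite {1}/bil va -scalemxAl mxE.
  rewrite -[X in a * X]/((v *m v^T) ord0 ord0).
  have -> : (v *m v^T) ord0 ord0 = sqn v.
    by rewrite -[RHS]mul1r -bil_scalar /bil mulmx1.
  rewrite ler_pM2r// lt_neqAle sqn_ge0 andbT eq_sym.
  by apply: contra v0 => /eqP/sqn_eq0 ->.
have el : eigenvalue M l.
  apply/eigenvalueP; exists w; last first.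
    apply/eqP => w0; move: w1; rewrite w0 /sqn big1 => [/eqP|i _].
      by rewrite eq_sym oner_eq0.
    by rewrite mxE expr0n.
  apply/eqP; rewrite -subr_eq0 -mul_mx_scalar -mulmxBr; apply/eqP.
  apply: nonpos_isotropic.
  - by rewrite linearB/= tr_scalar_mx sM.
  - by move=> v; rewrite bil_sub bil_scalar subr_le0.
  - by rewrite bil_sub bil_scalar w1 mulr1 subrr.
apply/eqP; rewrite eq_le; apply/andP; split.
  by apply: ub_le_sup => //; exists l.
by apply: ge_sup => //; exists l.
Qed.

Lemma bil_le_lambda_max M v : M^T = M -> bil M v v <= lambda_max M * sqn v.
Proof. by move=> /lambda_maxP[w []]. Qed.

(** As a maximum of the linear functions [M |-> bil M w w], the largest
eigenvalue is Lipschitz in the entries of the matrix. *)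
Lemma lambda_max_lip M N : M^T = M -> N^T = N ->
  lambda_max M <= lambda_max N + \sum_i \sum_j `|M i j - N i j|.
Proof.
move=> /lambda_maxP[w [w1 <- _]] sN.
have -> : bil M w w = bil N w w + bil (M - N) w w.
  by rewrite bil_sub addrC subrK.
apply: lerD; first by rewrite -[leRHS]mulr1 -w1 bil_le_lambda_max.
apply: le_trans (le_bil_unit _ w1) _.
by apply: ler_sum => i _; apply: ler_sum => j _; rewrite !mxE.
Qed.

Lemma continuous_lambda_max (T : topologicalType) (A : T -> 'M[R]_m) :
  (forall i j, continuous (fun x => A x i j)) -> (forall x, (A x)^T = A x) ->
  continuous (fun x => lambda_max (A x)).
Proof.
move=> cA sA x.
pose S y := \sum_i \sum_j `|A y i j - A x i j|.
have cS : continuous S.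
  apply: continuous_sum => i; apply: continuous_sum => j y.
  by apply: cvg_norm; apply: cvgB; [exact: cA|exact: cvg_cst].
have Sx : S x = 0.
  by rewrite /S big1// => i _; rewrite big1// => j _; rewrite subrr normr0.
apply: (@squeeze_cvgr _ _ _ _ (fun y => lambda_max (A x) - S y)
                              (fun y => lambda_max (A x) + S y)).
- apply: nearW => y; rewrite lambda_max_lip// andbT lerBlDr.
  rewrite (le_trans (lambda_max_lip (sA x) (sA y)))// lerD2l.
  by apply: ler_sum => i _; apply: ler_sum => j _; rewrite distrC.
- rewrite -[X in _ --> X]subr0 -Sx; apply: cvgB; [exact: cvg_cst|exact: cS].
- rewrite -[X in _ --> X]addr0 -Sx; apply: cvgD; [exact: cvg_cst|exact: cS].
Qed.

Lemma lambda_max_gt0 M : sym_posdef M -> 0 < lambda_max M.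
Proof.
move=> [sM pM]; have [w [w1 <- _]] := lambda_maxP sM.
apply: pM; apply/eqP => w0; move: w1; rewrite w0 /sqn big1 => [/eqP|i _].
  by rewrite eq_sym oner_eq0.
by rewrite mxE expr0n.
Qed.

End rayleigh.

(** * A family of truncated exponentials *)

Section cutoff.
Context {R : realType}.
Implicit Types (k eta s : R).

Definition pospart s : R := Num.max 0 s.

Lemma pospart_ge0 s : 0 <= pospart s.
Proof. by rewrite /pospart le_max lexx. Qed.

Lemma pospartM s : pospart s * s = pospart s ^+ 2.
Proof. by rewrite /pospart; case: leP => _; rewrite ?mul0r ?expr0n// expr2. Qed.

(** Squaring makes the positive part differentiable: the increment differs from
its linear part by at most [h^2]. *)
Lemma is_derive_pospart_sqr s :
  is_derive s 1 (fun t => pospart t ^+ 2) (2 * pospart s).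
Proof.
have H : h^-1 *: (((fun t => pospart t ^+ 2) \o shift s) (h *: 1)
   - pospart s ^+ 2) @[h --> 0^'] --> 2 * pospart s.
  apply/cvgrPdist_le => e e0; near=> h.
  have h0 : h != 0 by near: h; exact: nbhs_dnbhs_neq.
  have he : `|h| <= e by near: h; apply: dnbhs0_le.
  rewrite /= [h *: 1]mulr1 [_ *: _]mulrC.
  apply: le_trans _ he.
  have hgt0 : 0 < `|h| by rewrite normr_gt0.
  rewrite -(ler_pM2r hgt0) -normrM mulrBl divfK// -normrM -expr2.
  rewrite (ger0_norm (sqr_ge0 h)) ler_norml /pospart.
  case: (leP 0 s) => s0; case: (leP 0 (h + s)) => hs; nra.
by split; [apply/cvg_ex; exists (2 * pospart s)|exact/cvg_lim].
Unshelve. all: by end_near. Qed.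

(** A logistic damping of [exp (k s)], with the closed-form derivative
[k exp (- k s) theta^2]. *)
Definition theta k eta s : R := (expR (- k * s) + eta)^-1.

(** For [s >= 0], both factors increase when [eta] decreases to [0], the first one
to [exp (k s)] and the second one to [1]. The scale [eta^2] of the second factor balances the bound [1 / eta] on the
first one. *)
Definition cutoff k eta s : R := theta k eta s * pospart (1 - eta ^+ 2 * s) ^+ 2.

Definition dcutoff k eta s : R :=
  k * expR (- k * s) * theta k eta s ^+ 2 * pospart (1 - eta ^+ 2 * s) ^+ 2
  - 2 * eta ^+ 2 * (theta k eta s * pospart (1 - eta ^+ 2 * s)).

Lemma theta_gt0 k eta s : 0 < eta -> 0 < theta k eta s.
Proof. by move=> eta0; rewrite invr_gt0 addr_gt0// expR_gt0. Qed.

Lemma is_derive_theta k eta s : 0 < eta ->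
  is_derive s 1 (theta k eta) (k * expR (- k * s) * theta k eta s ^+ 2).
Proof.
move=> eta0.
have D0 : expR (- k * s) + eta != 0 by rewrite lt0r_neq0// addr_gt0// expR_gt0.
have Dlin : is_derive s 1 (fun t => - k * t) (0 * s + - k * 1).
  exact: is_derive_mul.
have Dexp := is_derive_chain (is_derive_expR _) Dlin.
have := is_derive_chain (f := fun t => expR (- k * t) + eta) (is_derive_inv D0)
  (is_derive_add Dexp (is_derive_const eta s 1)).
by move/is_derive_eq; apply; rewrite /theta; ring.
Qed.

Lemma is_derive_cutoff k eta s : 0 < eta ->
  is_derive s 1 (cutoff k eta) (dcutoff k eta s).
Proof.
move=> eta0.
have Dlin : is_derive s 1 (fun t => 1 + - eta ^+ 2 * t)
    (0 + (0 * s + - eta ^+ 2 * 1)).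
  apply: is_derive_add; exact: is_derive_mul.
have Dpos := is_derive_chain (is_derive_pospart_sqr _) Dlin.
have -> : cutoff k eta =
    fun t => theta k eta t * pospart (1 + - eta ^+ 2 * t) ^+ 2.
  by apply/funext => t; rewrite /cutoff mulNr.
apply: (is_derive_eq (is_derive_mul (is_derive_theta _ _ eta0) Dpos)).
have -> : 1 + - eta ^+ 2 * s = 1 - eta ^+ 2 * s by ring.
by rewrite /dcutoff; ring.
Qed.

Lemma continuous_pospart : continuous pospart.
Proof.
move=> s; apply: (@continuous_max R R (fun=> 0) id s).
  exact: cst_continuous.
exact: cvg_id.
Qed.

Lemma continuous_dcutoff k eta : 0 < eta -> continuous (dcutoff k eta).
Proof.
move=> eta0.
have cth : continuous (theta k eta).
  by apply: is_derive_continuous => s; exact: is_derive_theta.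
have clin a b : continuous (fun s : R => a + b * s).
  apply: continuous_add; first exact: cst_continuous.
  by apply: continuous_mul; [exact: cst_continuous|move=> s; exact: cvg_id].
have cpos : continuous (fun s => pospart (1 - eta ^+ 2 * s)).
  apply: (continuous_compose continuous_pospart).
  by under eq_fun do rewrite -mulNr; exact: clin.
have cexp : continuous (fun s : R => expR (- k * s)).
  apply: (continuous_compose (is_derive_continuous (@is_derive_expR R))).
  by apply: continuous_mul; [exact: cst_continuous|move=> s; exact: cvg_id].
have -> : dcutoff k eta = fun s =>
    k * expR (- k * s) * (theta k eta s * theta k eta s) *
    (pospart (1 - eta ^+ 2 * s) * pospart (1 - eta ^+ 2 * s)) +
    (- (2 * eta ^+ 2)) * (theta k eta s * pospart (1 - eta ^+ 2 * s)).
  by apply/funext => s; rewrite /dcutoff; ring.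
apply: continuous_add; last first.
  by apply: continuous_mul; [exact: cst_continuous|exact: continuous_mul].
apply: continuous_mul; last exact: continuous_mul.
apply: continuous_mul; last exact: continuous_mul.
by apply: continuous_mul => //; exact: cst_continuous.
Qed.

Lemma cutoff_ge0 k eta s : 0 < eta -> 0 <= cutoff k eta s.
Proof. by move=> eta0; rewrite mulr_ge0 ?sqr_ge0// ltW// theta_gt0. Qed.

Lemma pospart_eq0 eta s :
  0 < eta -> eta ^- 2 <= s -> pospart (1 - eta ^+ 2 * s) = 0.
Proof.
move=> eta0 hs; rewrite /pospart max_l// subr_le0.
by rewrite -ler_pdivrMl ?exprn_gt0// mulr1.
Qed.

Lemma pospart_le1 eta s : 0 <= s -> pospart (1 - eta ^+ 2 * s) <= 1.
Proof. by move=> s0; rewrite /pospart ge_max ler01 gerBl mulr_ge0// sqr_ge0. Qed.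

Lemma theta_le_exp k eta s : 0 < eta -> theta k eta s <= expR (k * s).
Proof.
move=> eta0; rewrite -[k * s]opprK -mulNr expRN.
by rewrite lef_pV2 ?posrE ?expR_gt0 ?addr_gt0 ?expR_gt0// lerDl ltW.
Qed.

Lemma cutoff_le_exp k eta s : 0 < eta -> 0 <= s -> cutoff k eta s <= expR (k * s).
Proof.
move=> eta0 s0; rewrite -[leRHS]mulr1 ler_pM ?theta_le_exp ?sqr_ge0//.
  by rewrite ltW// theta_gt0.
by rewrite expr_le1 ?pospart_ge0 ?pospart_le1.
Qed.

Lemma cutoff_anti k eta eta' s : 0 < eta -> eta <= eta' -> 0 <= s ->
  cutoff k eta' s <= cutoff k eta s.
Proof.
move=> eta0 le_eta s0; have eta'0 := lt_le_trans eta0 le_eta.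
apply: ler_pM; rewrite ?sqr_ge0 ?(ltW (theta_gt0 _ _ _))//.
  by rewrite lef_pV2 ?posrE ?addr_gt0 ?expR_gt0// lerD2l.
rewrite ler_pXn2r ?nnegrE ?pospart_ge0//.
rewrite /pospart ge_max le_max lexx/= le_max; apply/orP; right.
by rewrite lerD2l lerN2 ler_wpM2r// ler_pXn2r// nnegrE ltW.
Qed.

Lemma cvg_cutoff k s : cutoff k eta s @[eta --> 0] --> expR (k * s).
Proof.
have -> : expR (k * s) = cutoff k 0 s.
  rewrite /cutoff /theta addr0 -expRN expr0n/= mul0r subr0 /pospart max_r//.
  by rewrite expr1n mulr1 mulNr opprK.
apply: cvgM.
  apply: cvgV; first by rewrite addr0 lt0r_neq0// expR_gt0.
  by apply: cvgD; [exact: cvg_cst|exact: cvg_id].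
have clin : continuous (fun eta : R => 1 - eta ^+ 2 * s).
  have -> : (fun eta : R => 1 - eta ^+ 2 * s) = fun eta => 1 + - s * (eta * eta).
    by apply/funext => eta; ring.
  apply: continuous_add; first exact: cst_continuous.
  apply: continuous_mul; first exact: cst_continuous.
  by apply: continuous_mul => x; exact: cvg_id.
exact: (continuous_compose (@exprn_continuous _ 2)
  (continuous_compose continuous_pospart clin)).
Qed.

(** The right-hand side is uniform in [eta]. The derivative of the first factor
costs [4 k^2 s phi^2], absorbed by [c s phi^2]; that of the second one costs
at most [16]. What remains, [(b + 1 - (c - 4 k^2) s) phi^2], is positive only
for [s < (b + 1) / (c - 4 k^2)], where [phi <= exp (k s)] is bounded. *)
Lemma cutoff_energy k eta b c s :
  0 < k -> 4 * k ^+ 2 < c -> 0 < eta -> 0 <= b -> 0 <= s ->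
  (- c * s + b) * cutoff k eta s ^+ 2 + 2 * s * dcutoff k eta s ^+ 2 <=
  16 + (b + 1) * expR (k * ((b + 1) / (c - 4 * k ^+ 2))) ^+ 2 - cutoff k eta s ^+ 2.
Proof.
move=> k0 kc eta0 b0 s0.
set p := cutoff k eta s; set q := dcutoff _ _ _.
set r := (b + 1) / (c - 4 * k ^+ 2).
set th := theta k eta s; set e := expR (- k * s).
set po := pospart (1 - eta ^+ 2 * s).
have th0 : 0 < th by exact: theta_gt0.
have e0 : 0 < e by exact: expR_gt0.
have po0 : 0 <= po by exact: pospart_ge0.
have po1 : po <= 1 by exact: pospart_le1.
have eth : e * th <= 1.
  by rewrite /th /theta ler_pdivrMr ?mul1r ?lerDl ?(ltW eta0)// addr_gt0.
have etath : eta * th <= 1.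
  by rewrite /th /theta ler_pdivrMr ?mul1r ?lerDr ?(ltW e0)// addr_gt0.
have q2 : 2 * s * q ^+ 2 <= 4 * k ^+ 2 * s * p ^+ 2 + 16.
  have -> : q = k * (e * th) * p - 2 * (eta * th) * eta * po.
    by rewrite /q /p /dcutoff /cutoff -/th -/po -/e; ring.
  have h1 : (k * (e * th) * p) ^+ 2 <= k ^+ 2 * p ^+ 2.
    rewrite exprMn exprMn ler_wpM2r ?sqr_ge0// ler_piMr ?sqr_ge0// expr_le1//.
    by rewrite mulr_ge0 ?ltW.
  have h2 : s * (2 * (eta * th) * eta * po) ^+ 2 <= 4.
    have -> : s * (2 * (eta * th) * eta * po) ^+ 2 =
      4 * ((eta * th) ^+ 2 * (eta ^+ 2 * s * po ^+ 2)) by ring.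
    have hpo : po * (1 - eta ^+ 2 * s) = po ^+ 2 by exact: pospartM.
    have hx : eta ^+ 2 * s * po ^+ 2 = po * (po * (1 - po)).
      have -> : po * (1 - po) = po * (eta ^+ 2 * s).
        by rewrite mulrBr mulr1 -expr2 -hpo; ring.
      by ring.
    have hx1 : eta ^+ 2 * s * po ^+ 2 <= 1.
      by rewrite hx !mulr_ile1 ?mulr_ge0 ?subr_ge0// gerBl.
    rewrite ler_piMr// mulr_ile1// ?expr_le1// ?mulr_ge0// ?sqr_ge0
      ?(ltW eta0) ?(ltW th0)//.
  set x := k * _ * p in h1 *; set y := 2 * _ * _ * po in h2 *.
  have h3 : s * x ^+ 2 <= s * (k ^+ 2 * p ^+ 2) by rewrite ler_wpM2l.
  have h4 : 0 <= s * (x + y) ^+ 2 by rewrite mulr_ge0 ?sqr_ge0.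
  lra.
have p2 : (b + 1 - (c - 4 * k ^+ 2) * s) * p ^+ 2 <= (b + 1) * expR (k * r) ^+ 2.
  have d0 : 0 < c - 4 * k ^+ 2 by rewrite subr_gt0.
  have [sr|rs] := leP s r.
    apply: (@le_trans _ _ ((b + 1) * p ^+ 2)).
      by rewrite ler_wpM2r ?sqr_ge0// gerBl mulr_ge0 ?(ltW d0).
    rewrite ler_wpM2l ?addr_ge0// ler_pXn2r ?nnegrE ?expR_ge0 ?cutoff_ge0//.
    by rewrite (le_trans (cutoff_le_exp _ eta0 s0))// ler_expR ler_wpM2l ?(ltW k0).
  apply: (@le_trans _ _ 0); last by rewrite mulr_ge0 ?sqr_ge0 ?addr_ge0.
  rewrite mulr_le0_ge0 ?sqr_ge0// subr_le0 mulrC -ler_pdivrMr//.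
  exact: ltW.
lra.
Qed.

End cutoff.

(** * The weighted energy estimate *)

Section pderiv.
Context {R : realType} {m : nat}.
Implicit Types (f : 'rV[R]_m -> R) (x : 'rV[R]_m).

Lemma Ck_continuous k f : Ck k f -> continuous f.
Proof. by case: k => [|k] []. Qed.

Lemma Ck_pderiv k f i : Ck k.+1 f -> Ck k (pderiv i f).
Proof. by move=> [_ /(_ i)[]]. Qed.

Lemma Ck_continuous_pderiv k f i : Ck k.+1 f -> continuous (pderiv i f).
Proof. by move=> /Ck_pderiv => /(_ i) /Ck_continuous. Qed.

Lemma Ck_is_derive k f i x :
  Ck k.+1 f -> is_derive x (delta_mx ord0 i) f (pderiv i f x).
Proof. by move=> [_ /(_ i)[df _]]; exact: derivableP. Qed.

Lemma is_derive_coord x i j :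
  is_derive x (delta_mx ord0 i) (fun y : 'rV[R]_m => y ord0 j) (j == i)%:R.
Proof.
have D : is_derive (0 : R) 1 (fun t : R => t * (j == i)%:R + x ord0 j)
    (1 * (j == i)%:R + 0 * 0 + 0).
  by apply: is_derive_add; exact: is_derive_mul.
apply: (is_derive_eq (is_derive_line _ D)); last by rewrite !mul0r !addr0 mul1r.
by move=> h; rewrite !mxE /GRing.scale/= mulr1 addr0.
Qed.

Variable x0 : 'rV[R]_m.

Definition sqdist x : R := \sum_i (x ord0 i - x0 ord0 i) ^+ 2.

Lemma sqdist_ge0 x : 0 <= sqdist x.
Proof. by apply: sumr_ge0 => i _; exact: sqr_ge0. Qed.

Lemma euclid_dist_sqr x : euclid_dist x x0 ^+ 2 = sqdist x.
Proof. by rewrite sqr_sqrtr// sqdist_ge0. Qed.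

Lemma is_derive_sqdist x i :
  is_derive x (delta_mx ord0 i) sqdist (2 * (x ord0 i - x0 ord0 i)).
Proof.
have D j : is_derive x (delta_mx ord0 i)
    (fun y : 'rV[R]_m => (y ord0 j - x0 ord0 j) * (y ord0 j - x0 ord0 j))
    (2 * (x ord0 j - x0 ord0 j) * (j == i)%:R).
  have Dj := is_derive_add (is_derive_coord x i j)
    (is_derive_const (- x0 ord0 j) x (delta_mx ord0 i)).
  by apply: (is_derive_eq (is_derive_mul Dj Dj)); ring.
apply: (is_derive_eq (is_derive_bigsum _ D)).
rewrite (bigD1 i)//= eqxx mulr1 big1 ?addr0// => j /negPf ->.
by rewrite mulr0.
Qed.

Lemma continuous_sqdist : continuous sqdist.
Proof.
apply: continuous_sum => i; apply: (continuous_compose (@exprn_continuous R 2)).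
by apply: continuous_add; [exact: continuous_coord|exact: cst_continuous].
Qed.

End pderiv.

Section lyapunov.
Context {R : realType} {m : nat} (m_gt0 : (0 < m)%N).
Context (A : 'rV[R]_m -> 'M[R]_m) (V W : 'rV[R]_m -> R) (x0 : 'rV[R]_m).
Context (A_C1 : forall i j, Ck 1 (fun x => A x i j)).
Context (A_pos : forall x, sym_posdef (A x)).
Context (V_C2 : Ck 2 V) (W_C2 : Ck 2 W) (W_ge1 : forall x, 1 <= W x).

Let sA x : (A x)^T = A x. Proof. by case: (A_pos x). Qed.
Let W0 x : 0 < W x. Proof. exact: lt_le_trans (W_ge1 x). Qed.

(** Divergence form: up to the factor [w = exp (- V)], the right-hand side is
[div (w A grad W)]; the symmetry of [A] matches the first-order terms. *)
Lemma diffusion_op_divE x : 2 * diffusion_op A V W x =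
  \sum_i \sum_j (pderiv i (fun y => A y i j) x * pderiv j W x +
    A x i j * pderiv i (pderiv j W) x - A x i j * pderiv j W x * pderiv i V x).
Proof.
have Asym i j : (fun y => A y i j) = (fun y => A y j i).
  by apply/funext => y; rewrite -{1}(sA y) mxE.
rewrite /diffusion_op mulrDr mulrA mulfV ?mul1r ?pnatr_eq0// mulr_sumr.
have -> : \sum_i 2 * (drift A V i x * pderiv i W x) =
    \sum_i \sum_j (pderiv i (fun y => A y i j) x - A x i j * pderiv i V x)
      * pderiv j W x.
  rewrite exchange_big/=; apply: eq_bigr => i _.
  rewrite /drift !mulrA mulfV ?mul1r ?pnatr_eq0// mulr_suml; apply: eq_bigr => j _.
  by rewrite Asym -[in RHS](sA x) mxE.
rewrite -big_split/=; apply: eq_bigr => i _.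
by rewrite -big_split/=; apply: eq_bigr => j _; ring.
Qed.

Variables (phi dphi : R -> R) (r : R).
Hypothesis dphiE : forall s : R, is_derive s 1 phi (dphi s).
Hypothesis cdphi : continuous dphi.
Hypothesis phi0 : forall s, r ^+ 2 <= s -> phi s = 0.
Hypothesis dphi0 : forall s, r ^+ 2 <= s -> dphi s = 0.

Let w x := expR (- V x).
Let s x := sqdist x0 x.
(* [F] is the vector field [H A grad W], with [H = w phi^2 / W]; [dH i] and
   [G i] are the derivatives of [H] and [F i] along the coordinate [i]. *)
Let H x := w x * (phi (s x) * phi (s x)) * (W x)^-1.
Let dH i x := - pderiv i V x * H x
  + 2 * phi (s x) * dphi (s x) * (2 * (x ord0 i - x0 ord0 i)) * w x * (W x)^-1
  - pderiv i W x * (W x)^-1 * H x.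
Let F i x := (\sum_j A x i j * pderiv j W x) * H x.
Let G i x := (\sum_j (pderiv i (fun y => A y i j) x * pderiv j W x +
    A x i j * pderiv i (pderiv j W) x)) * H x +
  (\sum_j A x i j * pderiv j W x) * dH i x.

Let is_derive_H i x : is_derive x (delta_mx ord0 i) H (dH i x).
Proof.
have Dw := is_derive_chain (is_derive_expR _)
  (is_derive_mul (is_derive_const (-1) x (delta_mx ord0 i))
    (Ck_is_derive i x V_C2)).
have Dphi := is_derive_chain (dphiE _) (is_derive_sqdist x0 x i).
have DW := is_derive_chain (is_derive_inv (lt0r_neq0 (W0 x)))
  (Ck_is_derive i x W_C2).
have := is_derive_mul (is_derive_mul Dw (is_derive_mul Dphi Dphi)) DW.
have -> : H = fun y => expR (-1 * V y) * (phi (s y) * phi (s y)) * (W y)^-1.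
  by apply/funext => y; rewrite /H /w mulN1r.
move/is_derive_eq; apply.
rewrite /dH /H /w /s !mulN1r. ring.
Qed.

Let is_derive_F i x : is_derive x (delta_mx ord0 i) (F i) (G i x).
Proof.
apply: is_derive_mul; last exact: is_derive_H.
apply: is_derive_bigsum => j.
apply: is_derive_mul; first exact: Ck_is_derive (A_C1 i j).
exact: Ck_is_derive (Ck_pderiv j W_C2).
Qed.

Let continuous_dphi_s : continuous (fun x => dphi (s x)).
Proof.
exact: (@continuous_compose R _ dphi s cdphi (@continuous_sqdist _ _ x0)).
Qed.

Let continuous_phi_s : continuous (fun x => phi (s x)).
Proof.
exact: (@continuous_compose R _ phi s (is_derive_continuous dphiE)
  (@continuous_sqdist _ _ x0)).
Qed.

Let continuous_w : continuous w.
Proof.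
apply: (continuous_compose (is_derive_continuous (@is_derive_expR R))).
by apply: continuous_opp; exact: Ck_continuous V_C2.
Qed.

Let continuous_invW : continuous (fun x => (W x)^-1).
Proof.
by apply: continuous_inv => [x|]; [rewrite gt_eqF|exact: Ck_continuous W_C2].
Qed.

Let continuous_H : continuous H.
Proof.
by apply: continuous_mul => //; apply: continuous_mul => //; exact: continuous_mul.
Qed.

Let continuous_dH i : continuous (dH i).
Proof.
have cV : continuous (pderiv i V) by exact: Ck_continuous_pderiv V_C2.
have cW : continuous (pderiv i W) by exact: Ck_continuous_pderiv W_C2.
have c2 : continuous (fun x : 'rV[R]_m => (2 : R)) by exact: cst_continuous.
apply: continuous_add; last first.
  by apply: continuous_opp; apply: continuous_mul => //; exact: continuous_mul.
apply: continuous_add; first by apply: continuous_mul => //; exact: continuous_opp.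
apply: continuous_mul => //; apply: continuous_mul => //; apply: continuous_mul.
  by apply: continuous_mul => //; apply: continuous_mul.
apply: continuous_mul => //; apply: continuous_add; first exact: continuous_coord.
exact: cst_continuous.
Qed.

Let continuous_G i : continuous (G i).
Proof.
have cA j : continuous (fun x => A x i j) by exact: Ck_continuous (A_C1 i j).
have cdA j : continuous (pderiv i (fun x => A x i j)).
  exact: Ck_continuous_pderiv (A_C1 i j).
have cW j : continuous (pderiv j W) by exact: Ck_continuous_pderiv W_C2.
have cdW j : continuous (pderiv i (pderiv j W)).
  exact: Ck_continuous_pderiv (Ck_pderiv j W_C2).
apply: continuous_add; apply: continuous_mul => //; apply: continuous_sum => j;
  last exact: continuous_mul.
by apply: continuous_add; exact: continuous_mul.
Qed.

Let a := `|r| + \sum_i `|x0 ord0 i|.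

Let supp x : ~ cube m a x -> r ^+ 2 <= s x.
Proof.
move=> /existsNP[i /negP]; rewrite -ltNge => xi.
have xi0 : `|r| <= `|x ord0 i - x0 ord0 i|.
  have h1 : `|x0 ord0 i| <= \sum_i `|x0 ord0 i|.
    by rewrite (bigD1 i)//= lerDl sumr_ge0.
  have h2 := ler_normD (x ord0 i - x0 ord0 i) (x0 ord0 i).
  rewrite subrK in h2; move: xi; rewrite /a; lra.
rewrite -real_normK ?num_real// (le_trans (y := (x ord0 i - x0 ord0 i) ^+ 2))//.
  by rewrite -[leRHS]real_normK ?num_real// ler_pXn2r ?nnegrE.
by rewrite /s /sqdist (bigD1 i)//= lerDl sumr_ge0// => j _; exact: sqr_ge0.
Qed.

Let H0 x : ~ cube m a x -> H x = 0.
Proof. by move=> /supp sx; rewrite /H phi0// !(mulr0, mul0r). Qed.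

Let G0 i x : ~ cube m a x -> G i x = 0.
Proof.
move=> xa; rewrite /G /dH H0// dphi0 ?supp//.
by rewrite !(mulr0, mul0r, addr0, subrr).
Qed.

Let integral_sum_G : (\int[leb m]_x (\sum_i G i x)%:E = 0)%E.
Proof.
under eq_integral do rewrite -sumEFin.
rewrite integral_sum//= => [|i]; last exact: integrable_continuous_cube (G0 i).
rewrite big1// => i _; apply: integral_pderiv_eq0 (is_derive_F i) _ _ (G0 i) => //.
by move=> x xa; rewrite /F H0// mulr0.
Qed.

(* With [z = grad s], expanding [div F] leaves
   [2 phi phi' <u, A z> - phi^2 <u, A u>], which is at most [phi'^2 <z, A z>]
   because [A] is nonnegative at [phi u - phi' z]. *)
Let sum_G_le b c x :
  diffusion_op A V W x <= (- c * s x + b) * lambda_max (A x) * W x ->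
  \sum_i G i x <= 2 * (lambda_max (A x) * w x) *
    ((- c * s x + b) * phi (s x) ^+ 2 + 2 * s x * dphi (s x) ^+ 2).
Proof.
move=> LW.
pose u : 'rV[R]_m := \row_i (pderiv i W x / W x).
pose z : 'rV[R]_m := \row_i (2 * (x ord0 i - x0 ord0 i)).
set p := phi (s x); set q := dphi (s x).
have zE : sqn z = 4 * s x.
  by rewrite /sqn /s /sqdist mulr_sumr; apply: eq_bigr => i _; rewrite mxE; ring.
have HE : H x * W x = w x * p ^+ 2 by rewrite /H divfK ?gt_eqF// -expr2.
have -> : \sum_i G i x = H x * (2 * diffusion_op A V W x) +
    w x * (2 * p * q * bil (A x) u z - p ^+ 2 * bil (A x) u u).
  rewrite diffusion_op_divE (bilC u z (sA x)) !bil_sum.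
  have lin (f g h : 'I_m -> 'I_m -> R) (a1 a2 a3 : R) :
      a1 * (\sum_i \sum_j f i j) + a2 * (\sum_i \sum_j g i j) +
        a3 * (\sum_i \sum_j h i j) =
      \sum_i \sum_j (a1 * f i j + a2 * g i j + a3 * h i j).
    rewrite !mulr_sumr -!big_split/=; apply: eq_bigr => i _.
    by rewrite !mulr_sumr -!big_split.
  rewrite mulrBr addrA !mulrA -mulNr lin; apply: eq_bigr => i _.
  rewrite /G !mulr_suml -big_split/=; apply: eq_bigr => j _.
  by rewrite !mxE /dH /H -/p -/q; ring.
have pos_bil : 0 <= p ^+ 2 * bil (A x) u u - 2 * p * q * bil (A x) u z
    + q ^+ 2 * bil (A x) z z.
  have -> : p ^+ 2 * bil (A x) u u - 2 * p * q * bil (A x) u z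
      + q ^+ 2 * bil (A x) z z =
    bil (A x) (p *: u + - q *: z) (p *: u + - q *: z) by rewrite bil_expand//; ring.
  set y := _ + _; have [->|y0] := eqVneq y 0; first by rewrite /bil !mul0mx mxE.
  by apply: ltW; case: (A_pos x) => _; exact.
have zz := bil_le_lambda_max m_gt0 z (sA x).
rewrite zE in zz.
have w0 : 0 < w x by exact: expR_gt0.
have Hge0 : 0 <= H x.
  rewrite mulr_ge0 ?invr_ge0 ?(ltW (W0 x))// mulr_ge0 ?(ltW w0)//.
  by rewrite -expr2 sqr_ge0.
have h1 : H x * (2 * diffusion_op A V W x) <=
    2 * (w x * p ^+ 2) * ((- c * s x + b) * lambda_max (A x)).
  rewrite -HE; have := ler_wpM2l Hge0 LW; lra.
have h2 : w x * (2 * p * q * bil (A x) u z - p ^+ 2 * bil (A x) u u) <=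
    w x * (q ^+ 2 * (lambda_max (A x) * (4 * s x))).
  rewrite ler_wpM2l ?(ltW w0)//.
  have := ler_wpM2l (sqr_ge0 q) zz; lra.
lra.
Qed.

(** The function [phi^2 lam w + div F / 2] has the same integral as
[phi^2 lam w] and is pointwise at most [K lam w]. *)
Lemma weighted_energy_le b c K :
  (leb m).-integrable setT (fun x => (lambda_max (A x) * expR (- V x))%:E) ->
  (forall x, diffusion_op A V W x <=
    (- c * sqdist x0 x + b) * lambda_max (A x) * W x) ->
  (forall t, 0 <= t ->
    (- c * t + b) * phi t ^+ 2 + 2 * t * dphi t ^+ 2 <= K - phi t ^+ 2) ->
  (\int[leb m]_x (phi (sqdist x0 x) ^+ 2 * lambda_max (A x) * expR (- V x))%:E <=
   K%:E * \int[leb m]_x (lambda_max (A x) * expR (- V x))%:E)%E.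
Proof.
move=> ilam LW phiK.
pose g x := phi (s x) ^+ 2 * lambda_max (A x) * w x.
pose h x := 2^-1 * \sum_i G i x.
have clam : continuous (fun x => lambda_max (A x)).
  by apply: continuous_lambda_max => // i j; exact: Ck_continuous (A_C1 i j).
have ig : (leb m).-integrable setT (EFin \o g).
  apply: (@integrable_continuous_cube _ _ g a).
    apply: continuous_mul => //; apply: continuous_mul => //.
    exact: continuous_mul.
  by move=> x xa; rewrite /g phi0 ?supp// expr0n !mul0r.
have iG : (leb m).-integrable setT (fun x => (\sum_i G i x)%:E).
  apply: (@integrable_continuous_cube _ _ (fun x => \sum_i G i x) a).
    exact: continuous_sum.
  by move=> x xa; apply: big1 => i _; exact: G0.
have ih : (leb m).-integrable setT (EFin \o h).
  have -> : EFin \o h = (fun x => 2^-1%:E * (\sum_i G i x)%:E)%E by [].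
  exact: integrableZl.
have -> : (\int[leb m]_x (g x)%:E = \int[leb m]_x (g x + h x)%:E)%E.
  under [RHS]eq_integral do rewrite EFinD.
  rewrite (integralD measurableT ig ih).
  under [X in (_ + X)%E]eq_integral do rewrite /= EFinM.
  by rewrite (integralZl measurableT iG) integral_sum_G mule0 adde0.
rewrite -(integralZl measurableT ilam).
apply: le_integral => //.
- have -> : (fun x => (g x + h x)%:E) = ((EFin \o g) \+ (EFin \o h))%E by [].
  exact: integrableD.
- exact: integrableZl.
move=> x _; rewrite lee_fin /g /h.
have h1 := sum_G_le (LW x).
have h2 := phiK _ (sqdist_ge0 x0 x).
have lw0 : 0 <= lambda_max (A x) * w x.
  by rewrite mulr_ge0 ?expR_ge0// ltW// lambda_max_gt0.
have h3 := ler_wpM2l lw0 h2.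
rewrite -/(w x) -/(s x) in h3 *; lra.
Qed.

End lyapunov.

(** * Exponential integrability *)

Theorem proposition1p4 (R : realType) (m : nat) (m_gt0 : (0 < m)%N)
  (A : 'rV[R]_m -> 'M[R]_m) (V : 'rV[R]_m -> R)
  (A_C1 : forall i j, Ck 1 (fun x => A x i j))
  (A_pos : forall x, sym_posdef (A x))
  (V_C2 : Ck 2 V)
  (mu : probability 'rV[R]_m R)
  (mu_density : forall B : set 'rV[R]_m, measurable B ->
     mu B = (\int[lebesgue_rV m]_(x in B) (expR (- V x))%:E)%E)
  (lambda_max_int : (\int[mu]_x (lambda_max (A x))%:E < +oo)%E)
  (W : 'rV[R]_m -> R) (b c : R) (x0 : 'rV[R]_m)
  (W_C2 : Ck 2 W)
  (W_ge1 : forall x, 1 <= W x)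
  (b_ge0 : 0 <= b)
  (c_gt0 : 0 < c)
  (W_lyapunov : forall x, diffusion_op A V W x <=
     (- c * euclid_dist x x0 ^+ 2 + b) * lambda_max (A x) * W x) :
  forall delta : R, delta < Num.sqrt c ->
    (\int[mu]_x (expR (delta * euclid_dist x x0 ^+ 2) * lambda_max (A x))%:E < +oo)%E.
Proof.
move=> delta delta_lt.
pose lam x := lambda_max (A x).
have lam0 x : 0 <= lam x by rewrite ltW// lambda_max_gt0.
have clam : continuous lam.
  apply: continuous_lambda_max => // [i j|x]; first exact: Ck_continuous (A_C1 i j).
  by case: (A_pos x).
pose w x := expR (- V x).
have cw : continuous w.
  apply: (continuous_compose (is_derive_continuous (@is_derive_expR R))).
  by apply: continuous_opp; exact: Ck_continuous V_C2.
have density (f : 'rV[R]_m -> R) : continuous f -> (forall x, 0 <= f x) ->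
    (\int[mu]_x (f x)%:E = \int[leb m]_x (f x * w x)%:E)%E.
  move=> cf f0; apply: (@ge0_integral_density R _ _ mu (leb m) w) => //.
  - by move=> x; exact: expR_ge0.
  - exact: continuous_measurable_rV.
  - exact: continuous_measurable_rV.
(* Any [k > 0] with [delta <= 2 k < sqrt c] would do; the maximum also covers
   nonpositive [delta]. *)
pose k := Num.max delta (Num.sqrt c / 2) / 2.
have sc0 : 0 < Num.sqrt c by rewrite sqrtr_gt0.
have k0 : 0 < k by rewrite divr_gt0// lt_max divr_gt0 ?orbT.
have k2 : 2 * k = Num.max delta (Num.sqrt c / 2) by rewrite mulrC divfK.
have dk : delta <= 2 * k by rewrite k2 le_max lexx.
have kc : 4 * k ^+ 2 < c.
  have -> : 4 * k ^+ 2 = (2 * k) ^+ 2 by ring.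
  rewrite -[ltRHS](sqr_sqrtr (ltW c_gt0)).
  rewrite ltr_pXn2r// ?nnegrE ?sqrtr_ge0//; last first.
    by rewrite mulr_ge0// ltW.
  by rewrite k2 gt_max delta_lt ltr_pdivrMr// ltr_pMr// ltr1n.
pose K := 16 + (b + 1) * expR (k * ((b + 1) / (c - 4 * k ^+ 2))) ^+ 2.
have cs := @continuous_sqdist R m x0.
pose f eta x := cutoff k eta (sqdist x0 x) ^+ 2 * lam x.
have f0 eta x : 0 <= f eta x by rewrite mulr_ge0 ?sqr_ge0.
have cf eta : 0 < eta -> continuous (f eta).
  move=> eta0; apply: continuous_mul => //.
  apply: (continuous_compose (@exprn_continuous R 2)).
  apply: (@continuous_compose R _ (cutoff k eta) (sqdist x0) _ cs).
  by apply: is_derive_continuous => t; exact: is_derive_cutoff.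
have ilam : (leb m).-integrable setT (fun x => (lam x * w x)%:E).
  apply/integrableP; split.
    apply/measurable_EFinP; apply: continuous_measurable_rV.
    exact: continuous_mul.
  under eq_integral do rewrite gee0_abs ?lee_fin ?mulr_ge0 ?expR_ge0//.
  by rewrite -density.
have bound eta : 0 < eta ->
    (\int[mu]_x (f eta x)%:E <= K%:E * \int[mu]_x (lam x)%:E)%E.
  move=> eta0; rewrite !density//; last exact: cf.
  apply: (@weighted_energy_le R m m_gt0 A V W x0 A_C1 A_pos V_C2 W_C2 W_ge1
    (cutoff k eta) (dcutoff k eta) (eta^-1) _ _ _ _ b c K) => //.
  - by move=> t; exact: is_derive_cutoff.
  - exact: continuous_dcutoff.
  - by move=> t; rewrite exprVn => ht; rewrite /cutoff pospart_eq0// expr0n mulr0.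
  - move=> t; rewrite exprVn => ht; rewrite /dcutoff pospart_eq0//.
    by rewrite expr0n !mulr0 subrr.
  - by move=> x; rewrite -euclid_dist_sqr.
  - by move=> t t0; exact: (cutoff_energy k0 kc eta0 b_ge0 t0).
have mono x : {homo (fun n => (f n.+1%:R^-1 x)%:E) :
    n p / (n <= p)%N >-> (n <= p)%E}.
  move=> n p np; rewrite lee_fin ler_wpM2r//.
  rewrite ler_pXn2r ?nnegrE ?cutoff_ge0 ?invr_gt0//.
  rewrite cutoff_anti ?invr_gt0 ?sqdist_ge0// lef_pV2 ?posrE ?ltr0n//.
  by rewrite ler_nat.
have cvgf x : (f n.+1%:R^-1 x)%:E @[n --> \oo] -->
    (expR (k * sqdist x0 x) ^+ 2 * lam x)%:E.
  apply: cvg_EFin; first exact: nearW.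
  have h : cutoff k n.+1%:R^-1 (sqdist x0 x) @[n --> \oo] -->
      expR (k * sqdist x0 x).
    exact: (cvg_comp _ _ (@cvg_harmonic R) (@cvg_cutoff R k (sqdist x0 x))).
  exact: (cvgM (cvgM h h) (cvg_cst (lam x))).
have mf n : measurable_fun setT (fun x => (f n.+1%:R^-1 x)%:E).
  apply/measurable_EFinP; apply: continuous_measurable_rV.
  by apply: cf; rewrite invr_gt0.
have limf := cvg_monotone_convergence (mu := mu) measurableT mf
  (fun n x _ => f0 _ x) (fun x _ => mono x).
have lim_le : (\int[mu]_x (expR (k * sqdist x0 x) ^+ 2 * lam x)%:E <=
    K%:E * \int[mu]_x (lam x)%:E)%E.
  under eq_integral do rewrite -(cvg_lim _ (cvgf _))//.
  rewrite -(cvg_lim _ limf)//; apply: lime_le.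
    by apply/cvg_ex; eexists; exact: limf.
  by apply: nearW => n; apply: bound; rewrite invr_gt0.
have cexp (g : 'rV[R]_m -> R) (a : R) :
    continuous g -> continuous (fun x => expR (a * g x)).
  move=> cg; apply: (continuous_compose (is_derive_continuous (@is_derive_expR R))).
  by apply: continuous_mul => //; exact: cst_continuous.
under eq_integral do rewrite euclid_dist_sqr.
apply: (@le_lt_trans _ _ (K%:E * \int[mu]_x (lam x)%:E)%E); last first.
  have K0 : 0 <= K by rewrite addr_ge0// mulr_ge0 ?sqr_ge0 ?addr_ge0.
  by rewrite lte_mul_pinfty ?lee_fin.
apply: le_trans lim_le; apply: ge0_le_integral => //.
- by move=> x _; rewrite lee_fin; exact: mulr_ge0 (expR_ge0 _) (lam0 x).
- apply/measurable_EFinP; apply: continuous_measurable_rV.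
  by apply: continuous_mul clam; exact: cexp.
- apply/measurable_EFinP; apply: continuous_measurable_rV.
  by apply: continuous_mul clam; apply: continuous_mul; exact: cexp.
- move=> x _; rewrite lee_fin; apply: ler_wpM2r; first exact: lam0.
  rewrite expr2 -expRD ler_expR -mulrDl ler_wpM2r ?sqdist_ge0//; lra.
Qed.
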